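(* Let $(\{R_i\}_{i\geq 0},\{t_i\}_{i\geq 0})$ be a perfectoid tower arising from some pair $(R,I_0)$, and let $(\{R^{s.\flat}_{i}\}_{i\geq 0},\{t^{s.\flat}_{i}\}_{i\geq 0})$ be its tilt associated to $(R,I_0)$. For every $j\geq 0$, the projection $\Phi^{(j)}_0:R_j^{s.\flat}\to R_j/I_0R_j$ induces an isomorphism $$\overline{\Phi^{(j)}_0}:R^{s.\flat}_j/I^{s.\flat}_0R^{s.\flat}_j\xrightarrow{\cong}R_j/I_{0}R_j;\quad a\bmod I^{s.\flat}_0R^{s.\flat}_j\mapsto\Phi^{(j)}_{0}(a).$$ Moreover, the family $\{\overline{\Phi^{(i)}_0}\}_{i\geq 0}$ is compatible with the transition maps, with the Frobenius endomorphisms and with the Frobenius projections; that is, for every $i\ge0$, $$\overline{\Phi^{(i+1)}_0}\circ\overline{t^{s.\flat}_i}=\overline{t_i}\circ\overline{\Phi^{(i)}_0},\qquad\overline{\Phi^{(i)}_0}\circ\mathrm{Frob}_{R_i^{s.\flat}/I_0^{s.\flat}R_i^{s.\flat}}=\mathrm{Frob}_{R_i/I_0R_i}\circ\overline{\Phi^{(i)}_0},\qquad\overline{\Phi^{(i)}_0}\circ F_i^{s.\flat}=F_i\circ\overline{\Phi^{(i+1)}_0},$$ where $\overline{t_i^{s.\flat}}:R_i^{s.\flat}/I_0^{s.\flat}R_i^{s.\flat}\to R_{i+1}^{s.\flat}/I_0^{s.\flat}R_{i+1}^{s.\flat}$ is the map induced by $t_i^{s.\flat}$.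
   Context: Fix a prime $p$. All rings are commutative and unital. A pair $(R,I_0)$ is a ring with an ideal. A tower of rings $(\{R_i\}_{i\ge 0},\{t_i\}_{i\ge 0})$ is a sequence of rings with ring maps $t_i:R_i\to R_{i+1}$; each $R_i$ is an algebra over $R_j$ ($j\le i$) via these maps. Torsion: for an ideal $I$ of a ring $A$ and an $A$-module $M$, $M_{I\text{-tor}}$ is the submodule of those $m\in M$ such that for every $x\in I$ there is $n>0$ with $x^nm=0$. Purely inseparable tower arising from $(R,I_0)$: (a) $R_0=R$ and $p\in I_0$; (b) for each $i\ge0$ the map $\overline{t_i}:R_i/I_0R_i\to R_{i+1}/I_0R_{i+1}$ induced by $t_i$ is injective; (c) for each $i\ge0$ the image of the Frobenius endomorphism of $R_{i+1}/I_0R_{i+1}$ is contained in the image of $\overline{t_i}$. Write $\overline{R_i}:=R_i/I_0R_i$. The $i$-th Frobenius projection is the unique ring map $F_i:\overline{R_{i+1}}\to\overline{R_i}$ such that $\overline{t_i}\circ F_i$ is the Frobenius endomorphism of $\overline{R_{i+1}}$. Perfectoid tower arising from $(R,I_0)$: a purely inseparable tower arising from $(R,I_0)$ such that moreover: (d) every $F_i$ is surjective; (e) every $I_0R_i$ is contained in the Jacobson radical of $R_i$; (f) $I_0$ is principal, and $R_1$ contains a principal ideal $I_1$ with (f-1) $I_1^p=I_0R_1$ and (f-2) $\ker(F_i)=I_1\overline{R_{i+1}}$ for every $i\ge0$; (g) for every $i\ge0$, $I_0(R_i)_{I_0\text{-tor}}=(0)$, and there is a (unique) bijection $(F_i)_{\mathrm{tor}}:(R_{i+1})_{I_0\text{-tor}}\to(R_i)_{I_0\text{-tor}}$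 compatible with $F_i$ under the natural maps $(R_k)_{I_0\text{-tor}}\hookrightarrow R_k\twoheadrightarrow\overline{R_k}$, $k=i,i+1$. Tilt: $R_j^{s.\flat}:=\varprojlim\{\cdots\xrightarrow{F_{j+1}}\overline{R_{j+1}}\xrightarrow{F_j}\overline{R_j}\}$, with $t_j^{s.\flat}:R_j^{s.\flat}\to R_{j+1}^{s.\flat}$, $(a_i)_{i\ge0}\mapsto(\overline{t_{j+i}}(a_i))_{i\ge0}$. $\Phi^{(j)}_0:R_j^{s.\flat}\to\overline{R_j}$ is $(a_i)_{i\ge0}\mapsto a_0$, and $I_0^{s.\flat}:=\ker(\Phi^{(0)}_0)\subseteq R_0^{s.\flat}$. The map $F_i^{s.\flat}:R_{i+1}^{s.\flat}/I_0^{s.\flat}R_{i+1}^{s.\flat}\to R_i^{s.\flat}/I_0^{s.\flat}R_i^{s.\flat}$ is the ring map induced by $R_{i+1}^{s.\flat}\to R_i^{s.\flat}$, $(a_m)_{m\ge0}\mapsto(F_{i+m}(a_m))_{m\ge0}$. $\mathrm{Frob}_A$ denotes the Frobenius endomorphism of an $\mathbb{F}_p$-algebra $A$. *)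

(* Defs.v *)
From HB Require Import structures.
From mathcomp Require Import all_boot all_algebra.
From mathcomp Require Import boolp classical_sets functions.

Set Implicit Arguments.
Unset Strict Implicit.
Unset Printing Implicit Defensive.

Import GRing.Theory.
Local Open Scope classical_set_scope.
Local Open Scope ring_scope.
Local Open Scope quotient_scope.

(* MathComp's [idealr] and its ring quotients only cover proper ideals of     *)
(* nonzero rings. Here rings and quotients may be zero (comPzRingType), and   *)
(* an ideal may be the unit ideal.                                            *)

HB.mixin Record isMulAbsorbing (R : comPzRingType) (S : R -> bool) := {
  idealM : forall a, {in S, forall u, a * u \in S}
}.

#[short(type="ideal")]
HB.structure Definition Ideal (R : comPzRingType) :=
  {S of GRing.ZmodClosed R S & isMulAbsorbing R S}.

Section IdealGen.
Variables (R : comPzRingType) (X : set R).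

Definition ideal_gen : R -> bool := fun x =>
  `[< exists n (c s : 'I_n -> R),
        (forall k, X (s k)) /\ x = \sum_(k < n) c k * s k >].

Lemma ideal_genM a : {in ideal_gen, forall u, a * u \in ideal_gen}.
Proof.
move=> _ /asboolP[n [c [s [Xs ->]]]]; apply/asboolP.
exists n, (fun k => a * c k), s; split=> //.
by rewrite mulr_sumr; apply: eq_bigr => k _; rewrite mulrA.
Qed.

Lemma ideal_gen_zmod : zmod_closed ideal_gen.
Proof.
split=> [|u v iu iv].
  by apply/asboolP; exists 0%N, (fun=> 0), (fun=> 0); split=> [[]|]//; rewrite big_ord0.
have {iv} : - v \in ideal_gen by rewrite -mulN1r ideal_genM.
move: iu => /asboolP[n [c [s [Xs ->]]]] /asboolP[m [d [t [Xt ->]]]].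
apply/asboolP; exists (n + m)%N.
exists (fun k => match fintype.split k with inl i => c i | inr i => d i end).
exists (fun k => match fintype.split k with inl i => s i | inr i => t i end).
split=> [k|]; first by case: (fintype.split k).
rewrite big_split_ord /=; congr (_ + _); apply: eq_bigr => k _.
  by rewrite -[lshift m k]/(unsplit (inl k)) unsplitK.
by rewrite -[rshift n k]/(unsplit (inr k)) unsplitK.
Qed.

HB.instance Definition _ := GRing.isZmodClosed.Build R ideal_gen ideal_gen_zmod.
HB.instance Definition _ := isMulAbsorbing.Build R ideal_gen ideal_genM.

Lemma mem_ideal_gen x : X x -> x \in ideal_gen.
Proof.
move=> Xx; apply/asboolP; exists 1%N, (fun=> 1), (fun=> x); split=> //.
by rewrite big_ord1 mul1r.
Qed.

End IdealGen.

Lemma ideal_gen_sub (R : comPzRingType) (X : set R) (I : ideal R) :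
  (forall x, X x -> x \in I) -> forall x, x \in ideal_gen X -> x \in I.
Proof.
move=> XI _ /asboolP[n [c [s [Xs ->]]]].
by apply: rpred_sum => k _; apply: idealM; apply: XI.
Qed.

(* For a ring map f : R -> S, the ideal I S. *)
Definition ideal_ext (R S : comPzRingType) (f : {rmorphism R -> S})
    (I : ideal R) : ideal S :=
  Ideal.clone S (ideal_gen (f @` [set` I])) _.

Definition principal (R : comPzRingType) (I : ideal R) : Prop :=
  exists a, I =i ideal_gen [set a].

Definition ideal_pow (R : comPzRingType) (I : ideal R) (n : nat) : ideal R :=
  Ideal.clone R
    (ideal_gen [set x | exists2 a : 'I_n -> R,
                          (forall k, a k \in I) & x = \prod_(k < n) a k]) _.

Section IdealKer.
Variables (R S : comPzRingType) (f : {rmorphism R -> S}).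

Definition ideal_ker : R -> bool := fun x => f x == 0.

Lemma ideal_ker_zmod : zmod_closed ideal_ker.
Proof.
split=> [|x y]; rewrite !unfold_in ?rmorph0 // => /eqP fx /eqP fy.
by rewrite rmorphB fx fy subrr.
Qed.

Lemma ideal_kerM a : {in ideal_ker, forall u, a * u \in ideal_ker}.
Proof. by move=> u; rewrite !unfold_in rmorphM => /eqP->; rewrite mulr0. Qed.

HB.instance Definition _ := GRing.isZmodClosed.Build R ideal_ker ideal_ker_zmod.
HB.instance Definition _ := isMulAbsorbing.Build R ideal_ker ideal_kerM.

End IdealKer.

Section IdealPreim.
Variables (R S : comPzRingType) (f : {rmorphism R -> S}) (J : ideal S).

Definition ideal_preim : R -> bool := fun x => f x \in J.

Let preimE x : (x \in ideal_preim) = (f x \in J). Proof. by []. Qed.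

Lemma ideal_preim_zmod : zmod_closed ideal_preim.
Proof.
split=> [|x y]; rewrite !preimE; first by rewrite rmorph0 rpred0.
by move=> fx fy; rewrite rmorphB rpredB.
Qed.

Lemma ideal_preimM a : {in ideal_preim, forall u, a * u \in ideal_preim}.
Proof. by move=> u; rewrite !preimE rmorphM => fu; apply: idealM. Qed.

HB.instance Definition _ :=
  GRing.isZmodClosed.Build R ideal_preim ideal_preim_zmod.
HB.instance Definition _ := isMulAbsorbing.Build R ideal_preim ideal_preimM.

End IdealPreim.

Lemma ideal_ext_map (R S S' : comPzRingType) (f : {rmorphism R -> S})
    (g : {rmorphism S -> S'}) (I : ideal R) (J : ideal S') :
  (forall a, a \in I -> g (f a) \in J) ->
  forall x, x \in ideal_ext f I -> g x \in J.
Proof.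
move=> fgI x xI; suff : x \in ideal_preim g J by [].
by apply: ideal_gen_sub xI => _ [a aI <-]; exact: fgI.
Qed.

Definition maximal_ideal (R : comPzRingType) (M : ideal R) : Prop :=
  1 \notin M /\
  forall J : ideal R, {subset M <= J} -> 1 \notin J -> {subset J <= M}.

Definition jacobson (R : comPzRingType) : set R :=
  [set x | forall M : ideal R, maximal_ideal M -> x \in M].
Arguments jacobson : clear implicits.

(* The I-torsion of S, viewed as an R-module through f : R -> S. *)
Definition torsion (R S : comPzRingType) (f : {rmorphism R -> S})
    (I : ideal R) : set S :=
  [set m | forall x, x \in I -> exists2 n, (0 < n)%N & f x ^+ n * m = 0].

Section IdealQuotient.
Variables (R : comPzRingType) (I : ideal R).

Definition iquot := Quotient.quot I.

HB.instance Definition _ := GRing.Zmodule.on iquot.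

Definition iproj (x : R) : iquot := \pi_(Quotient.quot I) x.

Lemma iprojP x y : iproj x = iproj y <-> x - y \in I.
Proof.
by rewrite Quotient.idealrBE; split=> [h|/eqP//]; apply/eqP.
Qed.

Lemma iproj_surj (x : iquot) : exists y, iproj y = x.
Proof. by exists (repr (x : Quotient.quot I)); rewrite /iproj reprK. Qed.

Lemma iproj_repr (x : iquot) : iproj (repr (x : Quotient.quot I)) = x.
Proof. by rewrite /iproj reprK. Qed.

Definition iquot_mul (x y : iquot) : iquot :=
  iproj (repr (x : Quotient.quot I) * repr (y : Quotient.quot I)).

Lemma iproj_mul x y : iproj (x * y) = iquot_mul (iproj x) (iproj y).
Proof.
apply/iprojP; set x' := repr _; set y' := repr _.
have Ix : x - x' \in I by apply/iprojP; rewrite iproj_repr.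
have Iy : y - y' \in I by apply/iprojP; rewrite iproj_repr.
rewrite -[x * y](addrNK (x * y')) -mulrBr -addrA -mulrBl.
by apply: rpredD; last rewrite mulrC; apply: idealM.
Qed.

Lemma iproj_sub : zmod_morphism iproj.
Proof. by move=> x y; rewrite /iproj raddfB. Qed.

Let iprojD x y : iproj (x + y) = iproj x + iproj y.
Proof. by rewrite /iproj raddfD. Qed.

Lemma iquot_mulA : associative iquot_mul.
Proof.
move=> x y z; have [a <-] := iproj_surj x.
have [b <-] := iproj_surj y; have [c <-] := iproj_surj z.
by rewrite -!iproj_mul mulrA.
Qed.

Lemma iquot_mulC : commutative iquot_mul.
Proof. by move=> x y; rewrite /iquot_mul mulrC. Qed.

Lemma iquot_mul1 : left_id (iproj 1) iquot_mul.
Proof.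
by move=> x; have [a <-] := iproj_surj x; rewrite -iproj_mul mul1r.
Qed.

Lemma iquot_mulDl : left_distributive iquot_mul +%R.
Proof.
move=> x y z; have [a <-] := iproj_surj x.
have [b <-] := iproj_surj y; have [c <-] := iproj_surj z.
by rewrite -iprojD -!iproj_mul mulrDl iprojD.
Qed.

HB.instance Definition _ := GRing.Zmodule_isComPzRing.Build iquot
  iquot_mulA iquot_mulC iquot_mul1 iquot_mulDl.

HB.instance Definition _ := GRing.isZmodMorphism.Build R iquot iproj iproj_sub.

Lemma iproj_monoid : monoid_morphism iproj.
Proof. by split=> // x y; rewrite iproj_mul. Qed.

HB.instance Definition _ :=
  GRing.isMonoidMorphism.Build R iquot iproj iproj_monoid.

End IdealQuotient.

Section QuotientMap.
Variables (R S : comPzRingType) (I : ideal R) (J : ideal S).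
Variables (f : {rmorphism R -> S}) (fIJ : forall x, x \in I -> f x \in J).

(* The map R/I -> S/J induced by f. *)
Definition iquot_map (x : iquot I) : iquot J :=
  iproj J (f (repr (x : Quotient.quot I))).

Lemma iquot_mapE x : iquot_map (iproj I x) = iproj J (f x).
Proof.
by apply/iprojP; rewrite -rmorphB fIJ //; apply/iprojP; rewrite iproj_repr.
Qed.

Lemma iquot_map_sub : zmod_morphism iquot_map.
Proof.
move=> x y; have [a <-] := iproj_surj x; have [b <-] := iproj_surj y.
by rewrite -rmorphB !iquot_mapE !rmorphB.
Qed.

Lemma iquot_map_monoid : monoid_morphism iquot_map.
Proof.
split=> [|x y]; first by rewrite -[1](rmorph1 (iproj I)) iquot_mapE !rmorph1.
have [a <-] := iproj_surj x; have [b <-] := iproj_surj y.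
by rewrite -rmorphM !iquot_mapE !rmorphM.
Qed.

End QuotientMap.

Definition iquot_morph (R S : comPzRingType) (I : ideal R) (J : ideal S)
    (f : {rmorphism R -> S}) (fIJ : forall x, x \in I -> f x \in J) :
    {rmorphism iquot I -> iquot J} :=
  HB.pack (@iquot_map R S I J f)
    (GRing.isZmodMorphism.Build _ _ _ (iquot_map_sub fIJ))
    (GRing.isMonoidMorphism.Build _ _ _ (iquot_map_monoid fIJ)).

Lemma iquot_morphE (R S : comPzRingType) (I : ideal R) (J : ideal S)
    (f : {rmorphism R -> S}) (fIJ : forall x, x \in I -> f x \in J) x :
  iquot_morph fIJ (iproj I x) = iproj J (f x).
Proof. exact: iquot_mapE. Qed.

(* [pFrobenius_aut] is only available in nonzero rings. *)
Definition frob (p : nat) (A : comPzRingType) (x : A) : A := x ^+ p.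

Lemma frobD (p : nat) (A : comPzRingType) : prime p -> p%:R = 0 :> A ->
  {morph @frob p A : x y / x + y}.
Proof.
move=> p_pr p0 x y; rewrite /frob.
have defp := prednK (prime_gt0 p_pr).
rewrite exprDn big_ord_recr subnn -defp big_ord_recl /= defp.
rewrite subn0 mulr1 mul1r bin0 binn big1 ?addr0 // => i _.
rewrite -mulr_natl; suff -> : ('C(p, bump 0 i))%:R = 0 :> A by rewrite mul0r.
have /dvdnP[k ->] : (p %| 'C(p, bump 0 i))%N.
  by rewrite prime_dvd_bin //= -{2}defp ltnS (valP i).
by rewrite natrM p0 mulr0.
Qed.

Record tower := Tower {
  tower_ring :> nat -> comPzRingType;
  tower_map : forall i, {rmorphism tower_ring i -> tower_ring i.+1} }.

Fixpoint tower_base (T : tower) (i : nat) : {rmorphism T 0 -> T i} :=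
  match i with
  | 0 => idfun
  | i.+1 => tower_map T i \o tower_base T i
  end.

Definition tower_tail (T : tower) : tower :=
  Tower (fun i => tower_map T i.+1).

Section TowerQuotient.
Variables (T : tower) (I0 : ideal (T 0)).

(* The ideal I_0 R_i. *)
Definition base_ideal (i : nat) : ideal (T i) := ideal_ext (tower_base T i) I0.

Definition tower_quot (i : nat) : comPzRingType := iquot (base_ideal i).

Lemma base_idealS i x : x \in base_ideal i -> tower_map T i x \in base_ideal i.+1.
Proof.
apply: ideal_ext_map => a aI.
by apply: mem_ideal_gen; exists a.
Qed.

Definition tower_qmap (i : nat) : {rmorphism tower_quot i -> tower_quot i.+1} :=
  iquot_morph (@base_idealS i).

Definition tower_qcast m n (e : m = n) (x : tower_quot m) : tower_quot n :=
  ecast k (tower_quot k) e x.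

Lemma tower_qcastK m n (e : m = n) x : tower_qcast e (tower_qcast (esym e) x) = x.
Proof. by case: _ / e x. Qed.

Lemma tower_qcast_sub m n (e : m = n) : zmod_morphism (tower_qcast e).
Proof. by case: _ / e. Qed.

Lemma tower_qcast_monoid m n (e : m = n) : monoid_morphism (tower_qcast e).
Proof. by case: _ / e. Qed.

HB.instance Definition _ m n (e : m = n) :=
  GRing.isZmodMorphism.Build _ _ (tower_qcast e) (tower_qcast_sub e).
HB.instance Definition _ m n (e : m = n) :=
  GRing.isMonoidMorphism.Build _ _ (tower_qcast e) (tower_qcast_monoid e).

End TowerQuotient.

(* The tower arises from the pair (T 0, I0). *)
Record purely_inseparable (p : nat) (T : tower) (I0 : ideal (T 0)) : Prop := {
  pi_charp : p%:R \in I0;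
  pi_inj : forall i, injective (tower_qmap I0 i);
  pi_frob : forall i,
    range (@frob p (tower_quot I0 i.+1)) `<=` range (tower_qmap I0 i) }.

Section FrobeniusProjection.
Variables (p : nat) (p_pr : prime p) (T : tower) (I0 : ideal (T 0)).
Variable (hT : purely_inseparable p I0).

Lemma tower_quot_charp i : p%:R = 0 :> tower_quot I0 i.
Proof.
rewrite -(rmorph_nat (iproj _)) -(rmorph0 (iproj _)); apply/iprojP.
rewrite subr0 -(rmorph_nat (tower_base T i)).
by apply: mem_ideal_gen; exists p%:R; first exact: pi_charp hT.
Qed.

Let frob_in i (x : tower_quot I0 i.+1) :
  exists y, tower_qmap I0 i y == frob p x.
Proof.
by have [|y _ <-] := pi_frob hT (i := i) (t := frob p x); [exists x | exists y].
Qed.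

Definition frob_fun i (x : tower_quot I0 i.+1) : tower_quot I0 i :=
  xchoose (frob_in x).

Lemma frob_funE i x : tower_qmap I0 i (frob_fun x) = frob p x.
Proof. exact/eqP/(xchooseP (frob_in x)). Qed.

Lemma frob_fun_sub i : zmod_morphism (@frob_fun i).
Proof.
have add x y : @frob_fun i (x + y) = frob_fun x + frob_fun y.
  apply: (pi_inj hT); rewrite rmorphD !frob_funE frobD //.
  exact: tower_quot_charp.
move=> x y; apply: (addIr (frob_fun y)).
by rewrite -add !subrK.
Qed.

Lemma frob_fun_monoid i : monoid_morphism (@frob_fun i).
Proof.
split=> [|x y]; apply: (pi_inj hT); rewrite ?rmorphM ?rmorph1 !frob_funE /frob.
  by rewrite expr1n.
by rewrite exprMn.
Qed.

(* The Frobenius projection F_i, determined by frob_projE and pi_inj. *)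
Definition frob_proj i : {rmorphism tower_quot I0 i.+1 -> tower_quot I0 i} :=
  HB.pack (@frob_fun i)
    (GRing.isZmodMorphism.Build _ _ _ (@frob_fun_sub i))
    (GRing.isMonoidMorphism.Build _ _ _ (@frob_fun_monoid i)).

Lemma frob_projE i : tower_qmap I0 i \o frob_proj i =1 @frob p _.
Proof. exact: frob_funE. Qed.

Lemma frob_proj_qmap i : frob_proj i \o tower_qmap I0 i =1 @frob p _.
Proof.
move=> x; apply: (pi_inj hT).
by rewrite -[LHS]/((tower_qmap I0 i \o frob_proj i) _) frob_projE /frob rmorphXn.
Qed.

Lemma frob_proj_cast m n (e : m = n) (e' : m.+1 = n.+1) x :
  frob_proj n (tower_qcast e' x) = tower_qcast e (frob_proj m x).
Proof. by case: _ / e in e' *; rewrite (eq_irrelevance e' erefl). Qed.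

Lemma tower_qmap_cast m n (e : m = n) (e' : m.+1 = n.+1) x :
  tower_qmap I0 n (tower_qcast e x) = tower_qcast e' (tower_qmap I0 m x).
Proof. by case: _ / e in e' *; rewrite (eq_irrelevance e' erefl). Qed.

End FrobeniusProjection.

Record perfectoid (p : nat) (p_pr : prime p) (T : tower) (I0 : ideal (T 0)) :
    Prop := {
  perf_pi : purely_inseparable p I0;
  perf_surj : forall i, range (frob_proj p_pr perf_pi i) = setT;
  perf_jac : forall i x, x \in base_ideal I0 i -> jacobson (T i) x;
  perf_principal : principal I0;
  perf_pillar : exists I1 : ideal (T 1),
    [/\ principal I1,
        ideal_pow I1 p =i base_ideal I0 1
      & forall i, ideal_ker (frob_proj p_pr perf_pi i) =i
          ideal_ext (iproj (base_ideal I0 i.+1) \o tower_base (tower_tail T) i)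
            I1];
  perf_tor0 : forall i a m, a \in I0 -> torsion (tower_base T i) I0 m ->
    tower_base T i a * m = 0;
  perf_tor_bij : forall i, exists Ftor : T i.+1 -> T i,
    set_bij (torsion (tower_base T i.+1) I0) (torsion (tower_base T i) I0) Ftor
    /\ forall m, torsion (tower_base T i.+1) I0 m ->
         iproj (base_ideal I0 i) (Ftor m)
         = frob_proj p_pr perf_pi i (iproj (base_ideal I0 i.+1) m) }.

Section InverseLimit.
Variables (A : nat -> comPzRingType) (F : forall i, {rmorphism A i.+1 -> A i}).

Record invlim := InvLim {
  invlim_seq :> forall i, A i;
  invlimP : forall i, F i (invlim_seq i.+1) = invlim_seq i }.

HB.instance Definition _ := gen_eqMixin invlim.
HB.instance Definition _ := gen_choiceMixin invlim.

Lemma invlim_ext (a b : invlim) : (forall i, a i = b i) -> a = b.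
Proof.
case: a b => [a aP] [b bP] /= eab.
have {}eab : a = b by apply: functional_extensionality_dep.
by case: _ / eab in bP *; congr InvLim; apply: Prop_irrelevance.
Qed.

Let zeroP i : F i 0 = 0. Proof. exact: rmorph0. Qed.
Let oneP i : F i 1 = 1. Proof. exact: rmorph1. Qed.
Let oppP (a : invlim) i : F i (- a i.+1) = - a i.
Proof. by rewrite rmorphN invlimP. Qed.
Let addP (a b : invlim) i : F i (a i.+1 + b i.+1) = a i + b i.
Proof. by rewrite rmorphD !invlimP. Qed.
Let mulP (a b : invlim) i : F i (a i.+1 * b i.+1) = a i * b i.
Proof. by rewrite rmorphM !invlimP. Qed.

Definition invlim0 := InvLim zeroP.
Definition invlim1 := InvLim oneP.
Definition invlim_opp a := InvLim (oppP a).
Definition invlim_add a b := InvLim (addP a b).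
Definition invlim_mul a b := InvLim (mulP a b).

Fact invlim_addA : associative invlim_add.
Proof. by move=> a b c; apply: invlim_ext => i; apply: addrA. Qed.
Fact invlim_addC : commutative invlim_add.
Proof. by move=> a b; apply: invlim_ext => i; apply: addrC. Qed.
Fact invlim_add0 : left_id invlim0 invlim_add.
Proof. by move=> a; apply: invlim_ext => i; apply: add0r. Qed.
Fact invlim_addN : left_inverse invlim0 invlim_opp invlim_add.
Proof. by move=> a; apply: invlim_ext => i; apply: addNr. Qed.
Fact invlim_mulA : associative invlim_mul.
Proof. by move=> a b c; apply: invlim_ext => i; apply: mulrA. Qed.
Fact invlim_mulC : commutative invlim_mul.
Proof. by move=> a b; apply: invlim_ext => i; apply: mulrC. Qed.
Fact invlim_mul1 : left_id invlim1 invlim_mul.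
Proof. by move=> a; apply: invlim_ext => i; apply: mul1r. Qed.
Fact invlim_mulDl : left_distributive invlim_mul invlim_add.
Proof. by move=> a b c; apply: invlim_ext => i; apply: mulrDl. Qed.

HB.instance Definition _ := GRing.isZmodule.Build invlim
  invlim_addA invlim_addC invlim_add0 invlim_addN.
HB.instance Definition _ := GRing.Zmodule_isComPzRing.Build invlim
  invlim_mulA invlim_mulC invlim_mul1 invlim_mulDl.

Definition invlim_proj (i : nat) (a : invlim) : A i := a i.

Fact invlim_proj_sub i : zmod_morphism (invlim_proj i).
Proof. by []. Qed.
Fact invlim_proj_monoid i : monoid_morphism (invlim_proj i).
Proof. by []. Qed.

HB.instance Definition _ i :=
  GRing.isZmodMorphism.Build _ _ (invlim_proj i) (invlim_proj_sub i).
HB.instance Definition _ i :=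
  GRing.isMonoidMorphism.Build _ _ (invlim_proj i) (invlim_proj_monoid i).

End InverseLimit.

Section Tilt.
Variables (p : nat) (p_pr : prime p) (T : tower) (I0 : ideal (T 0)).
Variable (hT : purely_inseparable p I0).

Local Notation Rbar := (tower_quot I0).
Local Notation F := (frob_proj p_pr hT).

(* The index is i + j rather than j + i because i.+1 + j is convertible to   *)
(* (i + j).+1; indices i + j.+1 and (i + j).+1 are reconciled by tower_qcast. *)
Definition flat (j : nat) : comPzRingType :=
  @invlim (fun i => Rbar (i + j)%N) (fun i => F (i + j)%N).

Fact flat_map_subproof j (a : flat j) i :
  F (i + j.+1)%N
    (tower_qcast (esym (addnS i.+1 j)) (tower_qmap I0 (i.+1 + j) (a i.+1)))
  = tower_qcast (esym (addnS i j)) (tower_qmap I0 (i + j) (a i)).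
Proof.
rewrite (@frob_proj_cast _ p_pr _ _ hT _ _ (esym (addnS i j))); congr tower_qcast.
rewrite -[LHS]/((F _ \o tower_qmap _ _) _) frob_proj_qmap -frob_projE /=.
by congr (tower_qmap I0 (i + j) _); apply: (@invlimP _ _ a i).
Qed.

Definition flat_map_fun j (a : flat j) : flat j.+1 :=
  @InvLim (fun i => Rbar (i + j.+1)%N) (fun i => F (i + j.+1)%N)
    (fun i => tower_qcast (esym (addnS i j)) (tower_qmap I0 (i + j) (a i)))
    (flat_map_subproof a).

Fact flat_map_sub j : zmod_morphism (@flat_map_fun j).
Proof.
move=> a b; apply: invlim_ext => k.
exact: (rmorphB (tower_qcast (esym (addnS k j)) \o tower_qmap I0 (k + j)) (invlim_seq a k) (invlim_seq b k)).
Qed.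
Fact flat_map_monoid j : monoid_morphism (@flat_map_fun j).
Proof.
split=> [|a b]; apply: invlim_ext => k.
  exact: (rmorph1 (tower_qcast (esym (addnS k j)) \o tower_qmap I0 (k + j))).
exact: (rmorphM (tower_qcast (esym (addnS k j)) \o tower_qmap I0 (k + j)) (invlim_seq a k) (invlim_seq b k)).
Qed.

HB.instance Definition _ j :=
  GRing.isZmodMorphism.Build _ _ (@flat_map_fun j) (flat_map_sub (j := j)).
HB.instance Definition _ j :=
  GRing.isMonoidMorphism.Build _ _ (@flat_map_fun j) (flat_map_monoid j).

Definition tilt : tower := @Tower flat (fun j => @flat_map_fun j).

Definition flat_proj0 (j : nat) : {rmorphism tilt j -> Rbar j} :=
  GRing.RMorphism.clone _ _
    (invlim_proj (F := fun i => F (i + j)%N) 0 : flat j -> Rbar (0 + j)%N) _.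

Definition tilt_ideal : ideal (tilt 0) :=
  Ideal.clone _ (ideal_ker (flat_proj0 0)) _.

Fact flat_frob_subproof i (a : flat i.+1) m :
  F (m + i)%N (F (m.+1 + i)%N (tower_qcast (addnS m.+1 i) (a m.+1)))
  = F (m + i)%N (tower_qcast (addnS m i) (a m)).
Proof.
congr (F _ _); rewrite (@frob_proj_cast _ p_pr _ _ hT _ _ (addnS m i)).
by congr tower_qcast; apply: (@invlimP _ _ a m).
Qed.

Definition flat_frob_fun i (a : flat i.+1) : flat i :=
  @InvLim (fun m => Rbar (m + i)%N) (fun m => F (m + i)%N)
    (fun m => F (m + i)%N (tower_qcast (addnS m i) (a m)))
    (flat_frob_subproof a).

Fact flat_frob_sub i : zmod_morphism (@flat_frob_fun i).
Proof.
move=> a b; apply: invlim_ext => k.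
exact: (rmorphB (F (k + i)%N \o tower_qcast (I0 := I0) (addnS k i)) (invlim_seq a k) (invlim_seq b k)).
Qed.
Fact flat_frob_monoid i : monoid_morphism (@flat_frob_fun i).
Proof.
split=> [|a b]; apply: invlim_ext => k.
  exact: (rmorph1 (F (k + i)%N \o tower_qcast (I0 := I0) (addnS k i))).
exact: (rmorphM (F (k + i)%N \o tower_qcast (I0 := I0) (addnS k i)) (invlim_seq a k) (invlim_seq b k)).
Qed.

HB.instance Definition _ i :=
  GRing.isZmodMorphism.Build _ _ (@flat_frob_fun i) (@flat_frob_sub i).
HB.instance Definition _ i :=
  GRing.isMonoidMorphism.Build _ _ (@flat_frob_fun i) (flat_frob_monoid i).

Lemma flat_frob_map i (a : tilt i) :
  flat_frob_fun (tower_map tilt i a) = a ^+ p.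
Proof.
apply: invlim_ext => m /=.
rewrite tower_qcastK.
rewrite -[LHS]/((F _ \o tower_qmap _ _) _) frob_proj_qmap /frob.
by rewrite -[RHS]/(invlim_proj m (a ^+ p)) rmorphXn.
Qed.

Lemma flat_frob_ideal i x : x \in base_ideal tilt_ideal i.+1 ->
  (@flat_frob_fun i : {rmorphism _ -> _}) x \in base_ideal tilt_ideal i.
Proof.
apply: ideal_ext_map => a aI /=; rewrite flat_frob_map.
have -> (b : tilt i) : b ^+ p = b ^+ p.-1 * b by rewrite -exprSr prednK ?prime_gt0.
by apply: idealM; apply: mem_ideal_gen; exists a.
Qed.

(* Induced by (a_m)_m |-> (F_{i+m} a_m)_m from the (i+1)-st tilt to the i-th. *)
Definition tilt_frob_proj i :
    {rmorphism tower_quot tilt_ideal i.+1 -> tower_quot tilt_ideal i} :=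
  iquot_morph (@flat_frob_ideal i).

End Tilt.

(* Main.v *)
(* The kernel of [F_i] is generated by the image of a generator [f1] of the   *)
(* first pillar. Lifting [f1] along the surjections [F_i] gives an element    *)
(* [g] of the tilt with [g_0 = 0], [g_1 = f1] and hence [g_(n+1) ^+ (p ^ n) = *)
(* f1]. If [a_0 = 0], each [a_n] is a multiple of [g_n]. The quotient         *)
(* [a_n / g_n] is unique up to the annihilator of [g_n], which lies in        *)
(* [ker F] plus the image of the [I_0]-torsion: [f1 * x = f0 * y] makes       *)
(* [x - u * f1 ^+ p.-1 * y] torsion, where [f0 = u * f1 ^+ p]. As [F] is      *)
(* bijective on torsion, torsion is killed by [g_n] and the choices can be    *)
(* corrected along it; one more application of [F] then makes them            *)
(* compatible, so that [a] is a multiple of [g].                              *)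

Require Import Defs.
From HB Require Import structures.
From mathcomp Require Import all_boot all_algebra.
From mathcomp Require Import boolp classical_sets.

Set Implicit Arguments.
Unset Strict Implicit.
Unset Printing Implicit Defensive.

Import GRing.Theory.
Local Open Scope ring_scope.

(** [Phi0] is onto because the [F] are, and its compatibility with transition maps and Frobenius
    projections is read off at component 0; the substance is its kernel. One [g] in the tilt of
    [R_0], with [g 0 = 0] and [g 1] the class of the pillar generator [f1], serves all levels: its
    image at level [j] still has [f1] at index 1, and by [flat_dvd] such an element divides
    everything that vanishes at index 0. The quotients are glued by [invlim_dvd]:
    [annihilator_pillar] places their ambiguity in torsion plus [ker F], and [flat_torbar] shows
    that [g] kills torsion. *)

Section IquotLift.
Variables (R S : comPzRingType) (I : ideal R) (f : {rmorphism R -> S}).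
Hypothesis fI : forall x, x \in I -> f x = 0.

Definition iquot_lift_fun (x : iquot I) : S := f (repr (x : Quotient.quot I)).

Lemma iquot_lift_funE x : iquot_lift_fun (iproj I x) = f x.
Proof.
apply/eqP; rewrite -subr_eq0 -rmorphB; apply/eqP/fI.
by apply/iprojP; rewrite iproj_repr.
Qed.

Fact iquot_lift_sub : zmod_morphism iquot_lift_fun.
Proof.
move=> x y; have [a <-] := iproj_surj x; have [b <-] := iproj_surj y.
by rewrite -rmorphB !iquot_lift_funE rmorphB.
Qed.

Fact iquot_lift_monoid : monoid_morphism iquot_lift_fun.
Proof.
split=> [|x y].
  by rewrite -[1](rmorph1 (iproj I)) iquot_lift_funE rmorph1.
have [a <-] := iproj_surj x; have [b <-] := iproj_surj y.
by rewrite -rmorphM !iquot_lift_funE rmorphM.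
Qed.

Definition iquot_lift : {rmorphism iquot I -> S} :=
  HB.pack iquot_lift_fun
    (GRing.isZmodMorphism.Build _ _ _ iquot_lift_sub)
    (GRing.isMonoidMorphism.Build _ _ _ iquot_lift_monoid).

Lemma iquot_liftE x : iquot_lift (iproj I x) = f x.
Proof. exact: iquot_lift_funE. Qed.

Lemma iquot_lift_bij :
  (forall x, f x = 0 -> x \in I) -> (forall y, exists x, f x = y) ->
  bijective iquot_lift.
Proof.
move=> kerf surjf; pose h y := iproj I (projT1 (cid (surjf y))).
have hK : cancel h iquot_lift.
  by move=> y; rewrite /h iquot_liftE; case: cid.
exists h => // x; have [a <-] := iproj_surj x.
apply/iprojP/kerf; rewrite rmorphB; case: cid => /= b fb.
by rewrite fb iquot_lift_funE subrr.
Qed.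

End IquotLift.

(** * Principal ideals *)

Lemma ideal_gen1P (R : comPzRingType) (a x : R) :
  x \in ideal_gen [set a]%classic <-> exists c, x = c * a.
Proof.
split=> [/asboolP[n [c [s [sa ->]]]]|[c ->]]; last first.
  by apply: ideal_genM; apply: mem_ideal_gen.
exists (\sum_k c k); rewrite mulr_suml; apply: eq_bigr => k _.
by rewrite (sa k).
Qed.

Lemma ideal_ext1P (R S : comPzRingType) (f : {rmorphism R -> S}) (I : ideal R)
    (a : R) (x : S) :
  I =i ideal_gen [set a]%classic ->
  x \in ideal_ext f I <-> exists c, x = c * f a.
Proof.
move=> Ia; split=> [/asboolP[n [c [s [sI ->]]]]|[c ->]]; last first.
  apply: idealM; apply: mem_ideal_gen; exists a => //.
  by rewrite /= Ia; apply: mem_ideal_gen.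
suff /choice[d dE] : forall k, exists d, s k = d * f a.
  by exists (\sum_k c k * d k); rewrite mulr_suml; apply: eq_bigr => k _;
     rewrite dE mulrA.
move=> k; have [b + <-] := sI k; rewrite /= Ia => /ideal_gen1P[d ->].
by exists (f d); rewrite rmorphM.
Qed.

Lemma ideal_pow1 (R : comPzRingType) (I : ideal R) (a : R) n x :
  I =i ideal_gen [set a]%classic -> x \in ideal_pow I n ->
  exists c, x = c * a ^+ n.
Proof.
move=> Ia /asboolP[m [c [s [sI ->]]]].
suff /choice[d dE] : forall k, exists d, s k = d * a ^+ n.
  by exists (\sum_k c k * d k); rewrite mulr_suml; apply: eq_bigr => k _;
     rewrite dE mulrA.
move=> k; have [b bI ->] := sI k.
have /choice[d dE] : forall l, exists d, b l = d * a.
  by move=> l; apply/ideal_gen1P; rewrite -Ia.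
exists (\prod_l d l); rewrite (eq_bigr _ (fun l _ => dE l)) big_split /=.
by rewrite prodr_const card_ord.
Qed.

(** * Lifting and division in inverse limits *)

Section InvlimLift.
Variables (A : nat -> comPzRingType) (F : forall i, {rmorphism A i.+1 -> A i}).
Hypothesis surjF : forall i y, exists x, F i x = y.

Lemma invlim_lift0 (x : A 0) : exists a : invlim F, a 0 = x.
Proof.
pose s := fix s i : A i :=
  if i is i.+1 then projT1 (cid (surjF (s i))) else x.
have sP i : F i (s i.+1) = s i by rewrite /=; case: cid.
by exists (InvLim sP).
Qed.

End InvlimLift.

Lemma invlim_lift1 (A : nat -> comPzRingType)
    (F : forall i, {rmorphism A i.+1 -> A i}) :
  (forall i y, exists x, F i x = y) ->
  forall x : A 1, exists a : invlim F, a 1 = x.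
Proof.
move=> surjF x.
have [a ax] := @invlim_lift0 (fun i => A i.+1) (fun i => F i.+1)
  (fun i => @surjF i.+1) x.
pose s i : A i := if i is i.+1 then a i else F 0 (a 0).
have sP i : F i (s i.+1) = s i by case: i => //= i; apply: (invlimP a).
by exists (InvLim sP).
Qed.

(* [N i] plays the role of the image of the torsion in [A i]. *)
Lemma invlim_dvd (A : nat -> comPzRingType)
    (F : forall i, {rmorphism A i.+1 -> A i}) (N : forall i, set (A i))
    (g a : invlim F) :
    (forall i y, exists x, F i x = y) ->
    (forall n x, F n x = 0 -> exists y, x = g n.+1 * y) ->
    (forall n x, g n.+1 * x = 0 -> exists2 z, N n.+1 z & F n (x - z) = 0) ->
    (forall n z, N n z -> g n * z = 0) ->
    (forall n z, N n z -> exists2 z', N n.+1 z' & F n z' = z) ->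
  a 0 = 0 -> exists b, a = g * b.
Proof.
move=> surjF kerF annF gN surjN a0.
(* A quotient at [n] is lifted along [F]; the error lies in [ker F], hence is a multiple of
   [g n.+1]. These quotients need not be compatible. *)
have dvd n : exists y, a n = g n * y.
  elim: n => [|n [y ay]]; first by exists 0; rewrite mulr0.
  have [y' Fy'] := surjF n y.
  have [|w ew] := kerF n (a n.+1 - g n.+1 * y').
    by rewrite rmorphB rmorphM !invlimP Fy' ay subrr.
  by exists (y' + w); rewrite mulrDr -ew subrKC.
(* [F n.+1 y0] and [y] differ by some [z] in [N] modulo [ker F]. Subtracting a lift of [z] leaves
   the product with [g n.+2] unchanged; the rest dies only after one more [F n]. *)
have step n (y : {y | a n.+1 = g n.+1 * y}) :
    exists y' : {y | a n.+2 = g n.+2 * y},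
      F n (F n.+1 (projT1 y')) = F n (projT1 y).
  case: y => y ay /=; have [y0 ay0] := dvd n.+2.
  have [|z Nz Fz] := annF n (F n.+1 y0 - y).
    by rewrite mulrBr -ay -[g n.+1]invlimP -rmorphM -ay0 invlimP subrr.
  have [z' Nz' Fz'] := surjN _ _ Nz.
  have ay' : a n.+2 = g n.+2 * (y0 - z') by rewrite mulrBr (gN _ _ Nz') subr0.
  exists (exist (fun y => a n.+2 = g n.+2 * y) _ ay') => /=; apply/eqP.
  by rewrite rmorphB Fz' -subr_eq0 -rmorphB addrAC Fz.
pose s := fix s n : {y | a n.+1 = g n.+1 * y} :=
  if n is n.+1 then projT1 (cid (step n (s n))) else cid (dvd 1).
have sP n : F n (F n.+1 (projT1 (s n.+1))) = F n (projT1 (s n)).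
  by rewrite [s n.+1]/=; case: cid.
(* Component [n] comes from a quotient at [n.+1], so agreement after [F n] is exactly
   compatibility. *)
exists (@InvLim A F (fun n => F n (projT1 (s n))) sP).
apply: invlim_ext => n; rewrite -[RHS]/(g n * F n (projT1 (s n))).
by rewrite -(invlimP g) -rmorphM -(projT2 (s n)) invlimP.
Qed.

(** * Torsion and the Frobenius projections *)

Section PerfectoidTower.
Variables (p : nat) (p_pr : prime p) (T : tower) (I0 : ideal (T 0)).
Hypothesis hT : perfectoid p_pr I0.

Local Notation hPI := (perf_pi hT).
Local Notation Rbar := (tower_quot I0).
Local Notation F := (frob_proj p_pr hPI).

Lemma frob_proj_surj i y : exists x, F i x = y.
Proof.
suff [x _ <-] : range (F i) y by exists x.
by rewrite (perf_surj hT).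
Qed.

(** Torsion is taken before reduction: [Rbar i] is killed by [I0], so its own torsion is
    everything. *)
Definition torbar i : set (Rbar i) :=
  (iproj (base_ideal I0 i) @` torsion (tower_base T i) I0)%classic.

Lemma torbarP i m : torsion (tower_base T i) I0 m ->
  torbar (iproj (base_ideal I0 i) m).
Proof. by exists m. Qed.

Lemma torsionM i m y :
  torsion (tower_base T i) I0 m -> torsion (tower_base T i) I0 (y * m).
Proof.
move=> mtor x /mtor[n n0 e]; exists n => //.
by rewrite mulrCA e mulr0.
Qed.

Lemma torbarM i x y : torbar y -> torbar (x * y : Rbar i).
Proof.
move=> [m mtor <-]; have [a <-] := iproj_surj x.
by rewrite -rmorphM; apply/torbarP/torsionM.
Qed.

(** If [m = c * f0] is killed by [f0 ^+ n], then [c] is killed by [f0 ^+ n.+1], so it is torsion and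
    [f0] kills it. Hence torsion embeds in [Rbar i]. *)
Lemma torsion_base_ideal i m :
  torsion (tower_base T i) I0 m -> m \in base_ideal I0 i -> m = 0.
Proof.
have [f0 I0f0] := perf_principal hT.
move=> mtor /(ideal_ext1P _ _ I0f0)[c mE].
have f0I : f0 \in I0 by rewrite I0f0; apply: mem_ideal_gen.
have [n n0 e] := mtor f0 f0I.
rewrite mE mulrC (perf_tor0 hT) // => x.
rewrite I0f0 => /ideal_gen1P[d ->]; exists n.+1 => //.
rewrite rmorphM exprMn -mulrA [tower_base T i f0 ^+ _]exprSr.
by rewrite -[_ * c]mulrA [_ * c]mulrC -mE e mulr0.
Qed.

Lemma frob_proj_torbar i z : torbar z -> torbar (F i z).
Proof.
have [Ftor [[Fim _ _] Fcompat]] := perf_tor_bij hT i.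
move=> [m mtor <-]; rewrite -Fcompat //.
by apply: torbarP; apply: Fim.
Qed.

Lemma frob_proj_torbar_inj i z : torbar z -> F i z = 0 -> z = 0.
Proof.
have [Ftor [[Fim Finj _] Fcompat]] := perf_tor_bij hT i.
have Ftor0 m : torsion (tower_base T i.+1) I0 m ->
    F i (iproj (base_ideal I0 i.+1) m) = 0 -> Ftor m = 0.
  move=> mtor; rewrite -Fcompat // -(rmorph0 (iproj _)) => /iprojP.
  by rewrite subr0; apply: torsion_base_ideal; apply: Fim.
have tor0 : torsion (tower_base T i.+1) I0 0.
  by move=> x _; exists 1%N => //; rewrite mulr0.
move=> [m mtor <-] Fm; suff -> : m = 0 by rewrite rmorph0.
by apply: Finj; rewrite ?inE // !Ftor0 ?rmorph0.
Qed.

Lemma frob_proj_torbar_surj i z :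
  torbar z -> exists2 z', torbar z' & F i z' = z.
Proof.
have [Ftor [[_ _ Fsurj] Fcompat]] := perf_tor_bij hT i.
move=> [m mtor <-]; have [m' m'tor <-] := Fsurj _ mtor.
by exists (iproj _ m'); [apply: torbarP|rewrite Fcompat].
Qed.

(** * The first pillar and its annihilator *)

Definition tail_proj i : {rmorphism T 1 -> Rbar i.+1} :=
  iproj (base_ideal I0 i.+1) \o tower_base (tower_tail T) i.

Lemma tail_projS i x : tail_proj i.+1 x = tower_qmap I0 i.+1 (tail_proj i x).
Proof. by rewrite iquot_morphE. Qed.

Lemma tower_baseS i x :
  tower_base T i.+1 x = tower_base (tower_tail T) i (tower_map T 0 x).
Proof. by elim: i => //= i ->. Qed.

Lemma pillar_generators : exists f0 f1 u,
  [/\ I0 =i ideal_gen [set f0]%classic, tower_map T 0 f0 = u * f1 ^+ p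
    & forall i x, F i x = 0 <-> exists y, x = y * tail_proj i f1].
Proof.
have [f0 I0f0] := perf_principal hT.
have [I1 [[f1 I1f1] I1p kerF]] := perf_pillar hT.
have : tower_base T 1 f0 \in ideal_pow I1 p.
  by rewrite I1p; apply/(ideal_ext1P _ _ I0f0); exists 1; rewrite mul1r.
move=> /(ideal_pow1 I1f1)[u f0E]; exists f0, f1, u; split=> // i x.
by rewrite -(ideal_ext1P _ _ I1f1) -kerF unfold_in; split=> /eqP.
Qed.

Section Pillar.
Variables (f0 : T 0) (f1 u : T 1).
Hypothesis I0f0 : I0 =i ideal_gen [set f0]%classic.
Hypothesis f0E : tower_map T 0 f0 = u * f1 ^+ p.
Hypothesis kerF :
  forall i x, F i x = 0 <-> exists y, x = y * tail_proj i f1.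

Lemma annihilator_pillar i x : tail_proj i f1 * x = 0 ->
  exists2 z, torbar z & F i (x - z) = 0.
Proof.
set phi := tower_base (tower_tail T) i.
have [a <-] := iproj_surj x; rewrite -[tail_proj i f1]/(iproj _ (phi f1)).
rewrite -rmorphM -(rmorph0 (iproj _)) => /iprojP; rewrite subr0.
move=> /(ideal_ext1P _ _ I0f0)[c]; rewrite tower_baseS f0E.
rewrite -/phi rmorphM rmorphXn => e.
(* Since [f1 * a = c * u * f1 ^+ p], this choice gives [f1 * z = 0]. *)
pose z := a - c * phi u * phi f1 ^+ p.-1.
exists (iproj _ z); last first.
  (* As [p >= 2], one factor [f1] can be split off [f1 ^+ p.-1]. *)
  apply/kerF; exists (iproj _ (c * phi u * phi f1 ^+ p.-2)).
  rewrite -[tail_proj i f1]/(iproj _ (phi f1)) -rmorphB -rmorphM subKr.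
  congr (iproj _ _).
  by case: (p) (prime_gt1 p_pr) => [|[|q]] // _; rewrite exprSr mulrA.
apply: torbarP => b; rewrite I0f0 => /ideal_gen1P[d ->]; exists 1%N => //.
have f1p : phi f1 ^+ p = phi f1 * phi f1 ^+ p.-1.
  by rewrite -exprS prednK ?prime_gt0.
have f1z : phi f1 * z = 0.
  rewrite mulrBr e f1p -[c * _ * _]mulrA.
  by rewrite [phi u * _]mulrCA [c * _]mulrCA subrr.
rewrite expr1 rmorphM (tower_baseS _ f0) f0E rmorphM rmorphXn -/phi f1p.
by rewrite [phi f1 * _]mulrC -!mulrA f1z !mulr0.
Qed.

Section Flat.
Variables (j : nat) (g : flat p_pr hPI j).
Hypothesis g1 : g 1%N = tail_proj j f1 :> Rbar j.+1.

(** Frobenius is [tower_qmap] after [F], and [F] lowers the index of [g], so each [p]-th power moves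
    one level down, ending at [g 1]. *)
Lemma flat_exp n :
  (g n.+1 : Rbar (n + j).+1) ^+ (p ^ n) = tail_proj (n + j) f1.
Proof.
elim: n => [|n IHn]; first by rewrite expr1.
have gE : F (n + j).+1 (g n.+2) = g n.+1 := invlimP g n.+1.
rewrite expnS exprM -[_ ^+ p]/(frob p _) -(frob_projE p_pr hPI).
rewrite -[(_ \o _) _]/(tower_qmap I0 _ (F (n + j).+1 (g n.+2))) gE.
by rewrite -rmorphXn IHn tail_projS.
Qed.

Lemma flat0 : g 0%N = 0 :> Rbar j.
Proof.
have <- : F j (g 1%N) = g 0%N := invlimP g 0.
by apply/kerF; exists 1; rewrite mul1r.
Qed.

(** [F] sends the torsion element [g n.+1 * z] to [g n * F z], which is 0 by induction, and [F] is
    injective on torsion. *)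
Lemma flat_torbar n z : @torbar (n + j) z -> g n * z = 0.
Proof.
elim: n z => [|n IHn] z ztor; first by rewrite flat0 mul0r.
have gE : F (n + j) (g n.+1) = g n := invlimP g n.
apply: frob_proj_torbar_inj; first exact: torbarM.
by rewrite rmorphM gE IHn //; apply: frob_proj_torbar.
Qed.

Lemma flat_dvd (a : flat p_pr hPI j) : a 0%N = 0 :> Rbar j ->
  exists b, a = g * b.
Proof.
apply: (@invlim_dvd _ _ (fun n => @torbar (n + j))) => [n y|n x|n x|n z|n z].
- exact: frob_proj_surj.
- move=> /kerF[y ->]; rewrite -flat_exp.
  have : (0 < p ^ n)%N by rewrite expn_gt0 prime_gt0.
  move=> /prednK <-; rewrite exprS mulrCA.
  by eexists; reflexivity.
- move=> gx; apply: annihilator_pillar; rewrite -flat_exp.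
  have : (0 < p ^ n)%N by rewrite expn_gt0 prime_gt0.
  by move=> /prednK <-; rewrite exprSr -mulrA [_ * x]gx mulr0.
- exact: flat_torbar.
- exact: frob_proj_torbar_surj.
Qed.

End Flat.
End Pillar.

(** * The kernel and image of [Phi0] *)

Lemma tower_qcast_id m (e : m = m) (x : Rbar m) : tower_qcast e x = x.
Proof. by rewrite (eq_irrelevance e erefl). Qed.

Local Notation J0 := (tilt_ideal p_pr hPI).
Local Notation Rflat := (tilt p_pr hPI).
Local Notation Phi0 := (flat_proj0 p_pr hPI).

Lemma flat_proj0_map i a :
  Phi0 i.+1 (tower_map Rflat i a) = tower_qmap I0 i (Phi0 i a).
Proof. exact: (@tower_qcast_id i.+1). Qed.

Lemma flat_proj0_frob i (a : Rflat i.+1) :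
  Phi0 i (@flat_frob_fun p p_pr T I0 hPI i a) = F i (Phi0 i.+1 a).
Proof. by congr (F i _); apply: (@tower_qcast_id i.+1). Qed.

Lemma flat_proj0_surj j y : exists a, Phi0 j a = y.
Proof.
exact: (@invlim_lift0 _ _ (fun i => @frob_proj_surj (i + j)) y).
Qed.

Lemma flat_proj0_ideal j a : a \in base_ideal J0 j -> Phi0 j a = 0.
Proof.
suff base0 b k : b \in J0 -> Phi0 k (tower_base Rflat k b) = 0.
  move=> aJ; apply/eqP; rewrite -[_ == _]/(a \in ideal_ker (Phi0 j)).
  apply: ideal_gen_sub aJ => _ [b bJ <-].
  by rewrite unfold_in; apply/eqP/base0.
move=> bJ; elim: k => [|k IHk]; first exact/eqP.
rewrite -[tower_base _ _ _]/(tower_map Rflat k (tower_base Rflat k b)).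
by rewrite flat_proj0_map IHk rmorph0.
Qed.

Lemma flat_proj0_ker j a : Phi0 j a = 0 -> a \in base_ideal J0 j.
Proof.
have [f0 [f1 [u [I0f0 f0E kerF]]]] := pillar_generators.
(* Prescribing [g 1] forces [g 0 = 0], because [f1] dies under [F]; thus [g] lies in [J0]. *)
have [g g1] := @invlim_lift1 _ _ (fun i => @frob_proj_surj (i + 0))
  (tail_proj 0 f1).
have gj1 k : tower_base Rflat k g 1%N = tail_proj k f1 :> Rbar k.+1.
  elim: k => [|k IHk]; first exact: g1.
  by rewrite tail_projS -IHk; apply: (@tower_qcast_id k.+2).
move=> a0; have [b ->] := flat_dvd I0f0 f0E kerF (gj1 j) a0.
rewrite mulrC; apply: idealM; apply: mem_ideal_gen; exists g => //.
exact/eqP/(flat0 kerF g1).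
Qed.

End PerfectoidTower.

Theorem lemma3p39 (p : nat) (p_pr : prime p) (T : tower) (I0 : ideal (T 0%N))
    (hT : perfectoid p_pr I0) :
  let hPI := perf_pi hT in
  let J0 := tilt_ideal p_pr hPI in
  exists Phibar : forall j, {rmorphism tower_quot J0 j -> tower_quot I0 j},
    [/\ forall j a,
          Phibar j (iproj (base_ideal J0 j) a) = flat_proj0 p_pr hPI j a,
        forall j, bijective (Phibar j)
      & forall i,
        [/\ Phibar i.+1 \o tower_qmap J0 i =1 tower_qmap I0 i \o Phibar i,
            Phibar i \o frob p (A := tower_quot J0 i)
              =1 frob p (A := tower_quot I0 i) \o Phibar i
          & Phibar i \o tilt_frob_proj p_pr hPI i
              =1 frob_proj p_pr hPI i \o Phibar i.+1]].
Proof.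
move=> hPI J0.
pose Phibar j : {rmorphism tower_quot J0 j -> tower_quot I0 j} :=
  iquot_lift (@flat_proj0_ideal p p_pr T I0 hT j).
have PhibarE j a :
    Phibar j (iproj (base_ideal J0 j) a) = flat_proj0 p_pr hPI j a.
  exact: iquot_liftE.
exists Phibar; split=> // [j|i].
  by apply: iquot_lift_bij; [apply: flat_proj0_ker|apply: flat_proj0_surj].
split=> x.
- have [a <-] := iproj_surj x.
  rewrite -[LHS]/(Phibar i.+1 (tower_qmap J0 i _)) iquot_morphE PhibarE.
  by rewrite -[RHS]/(tower_qmap I0 i (Phibar i _)) PhibarE flat_proj0_map.
- exact: rmorphXn.
- have [a <-] := iproj_surj x.
  rewrite -[LHS]/(Phibar i (tilt_frob_proj p_pr hPI i _)) iquot_morphE PhibarE.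
  rewrite -[RHS]/(frob_proj p_pr hPI i (Phibar i.+1 _)) PhibarE.
  exact: flat_proj0_frob.
Qed.
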